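(* Let $R=k[[x_1,\dots,x_n]]$ with maximal ideal $\mathfrak m$ and let $I\subsetneq R$ be a proper ideal. Define $f_I:R/I\to\mathbb Z_{\ge 0}\cup\{\infty\}$ as follows: for $g\in R/I$, $f_I(g)=0$ if $g\notin \mathfrak m/I$; $f_I(g)=m+1$ if $m\ge 0$ is an integer with $g\in I^{m\text{-}jc}/I$ and $g\notin I^{(m+1)\text{-}jc}/I$; and $f_I(g)=\infty$ if $g\in I^{\infty\text{-}jc}/I$. Then for all $x,y\in R/I$: (1) $f_I(1)=0$ and $f_I(0)=\infty$; (2) $f_I(x+y)\ge\min\{f_I(x),f_I(y)\}$; (3) $f_I(xy)\ge f_I(x)+f_I(y)$.
   Context: $k$ is an algebraically closed field of characteristic $0$. For an integer $m\ge 0$ put $P_m=k[x_i^{(j)}: 1\le i\le n,\ 1\le j\le m]$. For $g\in R$ define $D_0(g),\dots,D_m(g)\in P_m$ by $$g\Big(\sum_{j=1}^m x_1^{(j)}t^j,\dots,\sum_{j=1}^m x_n^{(j)}t^j\Big)\equiv\sum_{j=0}^m D_j(g)\,t^j \pmod{t^{m+1}}.$$ For an ideal $I\subset R$ let $\overline{I}_m\subset P_m$ be the ideal generated by all $D_j(g)$ with $g\in I$, $0\le j\le m$. (Here $P_m$ is the $m$-th jet ring $R_m$ modulo $\mathfrak m R_m$, and $\overline I_m$ is the image of the $m$-th jet ideal of $I$.) The $m$-th jet closure of $I$ is $$I^{m\text{-}jc}=\{f\in R: D_j(f)\in \overline I_m \text{ for all } 0\le j\le m\};$$ in particular $I^{0\text{-}jc}=I+\mathfrak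 m=\mathfrak m$ for proper $I$. The arc closure is $I^{\infty\text{-}jc}=\bigcap_{m\ge 0}I^{m\text{-}jc}$. The jet closures form a decreasing sequence of ideals containing $I$. *)

(* Defs.v *)
From HB Require Import structures.
From mathcomp Require Import all_boot all_order all_algebra.
From mathcomp Require Import ssrcomplements freeg mpoly.
From mathcomp Require Import boolp classical_sets.

Set Implicit Arguments.
Unset Strict Implicit.
Unset Printing Implicit Defensive.

Import GRing.Theory.
Local Open Scope ring_scope.

Record mpseries (n : nat) (k : comNzRingType) :=
  MPSeries { mpscoef :> 'X_{1..n} -> k }.

Section MPSeriesRing.
Variables (n : nat) (k : comNzRingType).
Local Notation R := (mpseries n k).
Implicit Types (f g h : R) (a b : 'X_{1..n}).

Lemma mpseriesP f g : f =1 g -> f = g.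
Proof. by case: f g => [f] [g] /= /funext ->. Qed.

HB.instance Definition _ := gen_eqMixin R.
HB.instance Definition _ := gen_choiceMixin R.

Definition mps_zero : R := MPSeries (fun=> 0).
Definition mps_opp f : R := MPSeries (fun a => - f a).
Definition mps_add f g : R := MPSeries (fun a => f a + g a).
Definition mps_one : R := MPSeries (fun a => (a == 0%MM)%:R).

(* Same convolution formula as mcoeffM; the degree bounds only make the index
   type of the sum finite. *)
Definition mps_mul f g : R := MPSeries (fun a =>
  \sum_(b : 'X_{1..n < (mdeg a).+1, (mdeg a).+1} | a == (b.1 + b.2)%MM)
     f b.1 * g b.2).

Definition mps_trunc d f : {mpoly k[n]} :=
  \sum_(a : 'X_{1..n < d}) f a *: 'X_[a].

Lemma mps_truncE d f a : (mdeg a < d)%N -> (mps_trunc d f)@_a = f a.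
Proof. exact: mcoeff_mpoly. Qed.

Lemma mps_mul_trunc d (p q : {mpoly k[n]}) f g :
    (forall b, (mdeg b < d)%N -> f b = p@_b) ->
    (forall b, (mdeg b < d)%N -> g b = q@_b) ->
  forall a, (mdeg a < d)%N -> mps_mul f g a = (p * q)@_a.
Proof.
move=> fp gq a ad; rewrite mcoeffM; apply: eq_bigr => b _.
by rewrite fp ?gq //; apply: leq_trans ad; apply: bmdeg.
Qed.

Lemma mps_addA : associative mps_add.
Proof. by move=> f g h; apply: mpseriesP => a /=; rewrite addrA. Qed.
Lemma mps_addC : commutative mps_add.
Proof. by move=> f g; apply: mpseriesP => a /=; rewrite addrC. Qed.
Lemma mps_add0 : left_id mps_zero mps_add.
Proof. by move=> f; apply: mpseriesP => a /=; rewrite add0r. Qed.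
Lemma mps_addN : left_inverse mps_zero mps_opp mps_add.
Proof. by move=> f; apply: mpseriesP => a /=; rewrite addNr. Qed.

HB.instance Definition _ :=
  GRing.isZmodule.Build R mps_addA mps_addC mps_add0 mps_addN.

Let trE d f b : (mdeg b < d)%N -> f b = (mps_trunc d f)@_b.
Proof. by move=> bd; rewrite mps_truncE. Qed.
Local Hint Resolve trE : core.

Lemma mps_mulA : associative mps_mul.
Proof.
move=> f g h; apply: mpseriesP => a; have ad := ltnSn (mdeg a).
set d := (mdeg a).+1 in ad.
rewrite (@mps_mul_trunc d (mps_trunc d f) (mps_trunc d g * mps_trunc d h)) //.
  rewrite (@mps_mul_trunc d (mps_trunc d f * mps_trunc d g) (mps_trunc d h)) //.
  - by rewrite mulrA.
  - by move=> b bd; rewrite (@mps_mul_trunc d (mps_trunc d f) (mps_trunc d g)) //; auto.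
  - by auto.
by auto.
by move=> b bd; rewrite (@mps_mul_trunc d (mps_trunc d g) (mps_trunc d h)) //; auto.
Qed.

Lemma mps_mulC : commutative mps_mul.
Proof.
move=> f g; apply: mpseriesP => a; have ad := ltnSn (mdeg a).
set d := (mdeg a).+1 in ad.
rewrite (@mps_mul_trunc d (mps_trunc d f) (mps_trunc d g)); auto.
by rewrite (@mps_mul_trunc d (mps_trunc d g) (mps_trunc d f)) 1?mulrC; auto.
Qed.

Lemma mps_mul1 : left_id mps_one mps_mul.
Proof.
move=> f; apply: mpseriesP => a; have ad := ltnSn (mdeg a).
set d := (mdeg a).+1 in ad.
rewrite (@mps_mul_trunc d 1 (mps_trunc d f)); auto.
  by rewrite mul1r mps_truncE.
by move=> b _; rewrite mcoeff1.
Qed.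

Lemma mps_mulDl : left_distributive mps_mul mps_add.
Proof.
move=> f g h; apply: mpseriesP => a /=; rewrite -big_split /=.
by apply: eq_bigr => b _; rewrite mulrDl.
Qed.

Lemma mps_oner_neq0 : mps_one != 0.
Proof.
apply/eqP => /(congr1 (fun f : R => f 0%MM)) /= /eqP.
by rewrite eqxx oner_eq0.
Qed.

HB.instance Definition _ := GRing.Zmodule_isComNzRing.Build R
  mps_mulA mps_mulC mps_mul1 mps_mulDl mps_oner_neq0.

End MPSeriesRing.

Section MPSeriesTheory.
Variables (n : nat) (k : comNzRingType).
Local Notation R := (mpseries n k).
Implicit Types (f g h : R) (a b : 'X_{1..n}).

Lemma mpsD f g a : (f + g) a = f a + g a. Proof. by []. Qed.
Lemma mpsN f a : (- f) a = - f a. Proof. by []. Qed.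
Lemma mps1 a : (1 : R) a = (a == 0%MM)%:R. Proof. by []. Qed.
Lemma mpsM f g a : (f * g) a =
  \sum_(b : 'X_{1..n < (mdeg a).+1, (mdeg a).+1} | a == (b.1 + b.2)%MM)
     f b.1 * g b.2.
Proof. by []. Qed.

Lemma mps_sum I (r : seq I) (P : pred I) (F : I -> R) a :
  (\sum_(i <- r | P i) F i) a = \sum_(i <- r | P i) F i a.
Proof. by apply: (big_morph (fun f : R => f a)). Qed.

Lemma mpsM_eq d f f' g g' a : (mdeg a < d)%N ->
    (forall b, (mdeg b < d)%N -> f b = f' b) ->
    (forall b, (mdeg b < d)%N -> g b = g' b) ->
  (f * g) a = (f' * g') a.
Proof.
move=> ad ff' gg'; rewrite !mpsM; apply: eq_bigr => b _.
by rewrite ff' ?gg' //; apply: leq_trans ad; apply: bmdeg.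
Qed.

Lemma mpsM0 f g : (f * g) 0%MM = f 0%MM * g 0%MM.
Proof.
have e b : (mdeg b < 1)%N -> b = 0%MM.
  by rewrite ltnS leqn0 mdeg_eq0 => /eqP.
rewrite (@mps_mul_trunc _ _ 1 (f 0%MM)%:MP (g 0%MM)%:MP) ?mdeg0 //.
- by rewrite -rmorphM /= mpolyCK.
- by move=> b /e ->; rewrite mpolyCK.
- by move=> b /e ->; rewrite mpolyCK.
Qed.

Lemma mpsX_lt h i a : h 0%MM = 0 -> (mdeg a < i)%N -> (h ^+ i) a = 0.
Proof.
move=> h0; elim: i a => // i IH a ai; rewrite exprS mpsM big1 // => -[b c] /= /eqP abc.
have [->|nz] := eqVneq (bmnm b) 0%MM; first by rewrite h0 mul0r.
rewrite IH ?mulr0 //; have := congr1 mdeg abc; rewrite mdegD => e.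
rewrite -mdeg_eq0 -lt0n in nz; rewrite e ltnS in ai.
by apply: leq_trans ai; rewrite -[X in (X < _)%N]add0n ltn_add2r.
Qed.

Lemma mps_geom h : h 0%MM = 0 -> exists g, (1 - h) * g = 1.
Proof.
move=> h0; exists (MPSeries (fun a => (\sum_(i < (mdeg a).+1) h ^+ i) a)).
apply: mpseriesP => a; set d := (mdeg a).+1.
rewrite (@mpsM_eq d _ (1 - h) _ (\sum_(i < d) h ^+ i)) //.
  rewrite -opprB mulNr -subrX1 opprB mpsD mpsN (@mpsX_lt h d) ?oppr0 ?addr0 //.
move=> b bd; rewrite /= !mps_sum (big_ord_widen_cond d xpredT (fun i => (h ^+ i) b)) //.
rewrite big_mkcond /=; apply: eq_bigr => i _; case: ltnP => // hi.
by rewrite mpsX_lt.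
Qed.

End MPSeriesTheory.

Lemma mps_unit n (k : fieldType) (f : mpseries n k) :
  f 0%MM != 0 -> exists g, f * g = 1.
Proof.
move=> f0; pose c : mpseries n k := MPSeries (fun a => (a == 0%MM)%:R * (f 0%MM)^-1).
have [|g fg] := @mps_geom n k (1 - c * f).
  by rewrite mpsD mpsN mps1 mpsM0 /= eqxx mul1r mulVf // subrr.
by exists (c * g); rewrite mulrA (mulrC f) -[c * f](subKr 1).
Qed.

Local Open Scope classical_set_scope.

Definition ideal_gen (A : comNzRingType) (S : set A) : set A :=
  [set p | exists2 s : seq (A * A),
     forall q, q \in s -> S q.2 & p = \sum_(q <- s) q.1 * q.2].

Section IdealGen.
Variables (A : comNzRingType) (S : set A).

Lemma ideal_gen_sub p : S p -> ideal_gen S p.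
Proof.
move=> Sp; exists [:: (1, p)]; last by rewrite big_seq1 mul1r.
by move=> q; rewrite inE => /eqP ->.
Qed.

Lemma ideal_gen0 : ideal_gen S 0.
Proof. by exists [::]; rewrite ?big_nil. Qed.

Lemma ideal_genD p q : ideal_gen S p -> ideal_gen S q -> ideal_gen S (p + q).
Proof.
move=> [s Ss ->] [t St ->]; exists (s ++ t); last by rewrite big_cat.
by move=> r; rewrite mem_cat => /orP[/Ss|/St].
Qed.

Lemma ideal_genM p q : ideal_gen S q -> ideal_gen S (p * q).
Proof.
move=> [s Ss ->]; exists [seq (p * r.1, r.2) | r <- s].
  by move=> _ /mapP[r /Ss ? ->].
by rewrite big_map mulr_sumr; apply: eq_bigr => r _; rewrite mulrA.
Qed.

Lemma ideal_gen_min (T : set A) : T 0 -> (forall p q, T p -> T q -> T (p + q)) ->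
    (forall p q, T q -> T (p * q)) -> S `<=` T -> ideal_gen S `<=` T.
Proof.
move=> T0 TD TM ST p [s Ss ->]; elim: s Ss => [|q s IH] Ss; rewrite ?big_nil ?big_cons //.
apply: TD; first by apply/TM/ST/Ss; rewrite mem_head.
by apply: IH => r rs; apply: Ss; rewrite inE rs orbT.
Qed.

End IdealGen.

Section JetClosure.
Variables (n : nat) (k : comNzRingType).
Local Notation R := (mpseries n k).

Definition mps_var (i : 'I_n) : R := MPSeries (fun a => (a == U_(i)%MM)%:R).

(* The maximal ideal (x_1, ..., x_n). *)
Definition mps_max : set R := ideal_gen (range mps_var).

Lemma mps_varM (i : 'I_n) (g : R) a :
  (g * mps_var i) a = if (0 < a i)%N then g (a - U_(i))%MM else 0.
Proof.
set d := (mdeg a).+1.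
rewrite (@mps_mul_trunc _ _ d (mps_trunc d g) 'X_i) //; first last.
- by move=> b _; rewrite mcoeffX eq_sym.
- by move=> b bd; rewrite mps_truncE.
case: ifP => ai.
  have e : a = (U_(i) + (a - U_(i)))%MM by rewrite addmC submK // lep1mP -lt0n.
  rewrite {1}e mcoeffMX mps_truncE // /d ltnS; exact: mdegB.
rewrite mcoeffM big1 // => -[b c] /= /eqP abc; rewrite mcoeffX.
case: eqP => [ci|]; last by rewrite mulr0.
by have := congr1 (fun c : 'X_{1..n} => c i) abc; rewrite mnmDE -ci mnm1E eqxx addn1 => e; rewrite e in ai.
Qed.

Lemma mps_maxP (f : R) : mps_max f <-> f 0%MM = 0.
Proof.
split=> [|f0].
  apply: (@ideal_gen_min _ _ [set f : R | f 0%MM = 0]) => //.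
  - by move=> p q /= p0 q0; rewrite p0 q0 addr0.
  - by move=> p q q0; rewrite /mkset mpsM0 q0 mulr0.
  - by move=> _ [i _ <-] /=; rewrite eq_sym mnm1_eq0.
pose g (i : 'I_n) : R := MPSeries (fun b =>
  if [forall j : 'I_n, (j < i)%N ==> (b j == 0%N)] then f (b + U_(i))%MM else 0).
exists [seq (g i, mps_var i) | i <- enum 'I_n].
  by move=> _ /mapP[i _ ->]; exists i.
rewrite big_map big_enum; apply: mpseriesP => a; rewrite mps_sum.
have [->|/eqP nz] := eqVneq a 0%MM.
  by rewrite f0 big1 // => i _; rewrite mps_varM mnm0E.
have [i0 Hi0] : exists i, (0 < a i)%N.
  apply/existsP; rewrite -[X in is_true X]negbK negb_exists; apply/negP => /forallP H.
  by apply: nz; apply/mnmP => i; rewrite mnm0E; have := H i; rewrite -eqn0Ngt => /eqP.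
have [i ai imin] := @arg_minnP _ i0 (fun i => (0 < a i)%N) (fun i => i : nat) Hi0.
rewrite (bigD1 i) // big1 => [|j ji]; rewrite mps_varM ?addr0.
  rewrite ai /= submK ?lep1mP -?lt0n // addr0; case: ifP => // /negbT/negP[].
  apply/forallP => j; apply/implyP => ji; rewrite mnmBE.
  case: (posnP (a j)) => [->//|/imin]; by rewrite leqNgt ji.
case: ifP => // aj; rewrite /=; case: ifP => // /forallP /(_ i).
have ij : (i < j)%N by rewrite ltn_neqAle imin // andbT eq_sym.
rewrite ij /= mnmBE mnm1E (negbTE ji) subn0 => /eqP ai0.
by rewrite ai0 in ai.
Qed.

(* The variable x_i^(j), 1 <= j <= m, is 'X_(mxvec_index i (j - 1)). *)
Local Notation jet_ring m := {mpoly k[n * m]}.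

Definition jet_arc m (i : 'I_n) : {poly jet_ring m} :=
  \sum_(j < m) ('X_(mxvec_index i j) : jet_ring m)%:P * 'X^(j.+1).

(* D_j(g). Each jet_arc m i is divisible by 'X (which plays the role of t), so the
   monomials of g of degree > m contribute only multiples of 'X^(m.+1). *)
Definition jet_coef m (j : nat) (g : R) : jet_ring m :=
  (mmap (fun c : k => (c%:MP : jet_ring m)%:P) (jet_arc m)
     (mps_trunc m.+1 g))`_j.

Lemma jet_arc_divX m i : exists B, jet_arc m i = B * 'X.
Proof.
exists (\sum_(j < m) ('X_(mxvec_index i j) : jet_ring m)%:P * 'X^j).
by rewrite mulr_suml; apply: eq_bigr => j _; rewrite exprSr mulrA.
Qed.

Lemma mmap1_jet_arc_coef m a j :
  (j < mdeg a)%N -> (mmap1 (jet_arc m) a)`_j = 0.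
Proof.
move=> ja; have [B HB] := choice (@jet_arc_divX m).
rewrite /mmap1 (eq_bigr (fun i => B i ^+ a i * 'X ^+ a i)); last first.
  by move=> i _; rewrite HB exprMn.
by rewrite big_split /= prodrXr -mdegE coefMXn ja.
Qed.

Lemma jet_coefE m j (f : R) (p : {mpoly k[n]}) : (j <= m)%N ->
    (forall a, (mdeg a <= j)%N -> f a = p@_a) ->
  jet_coef m j f =
  (mmap (fun c : k => (c%:MP : jet_ring m)%:P) (jet_arc m) p)`_j.
Proof.
move=> jm fp; apply/eqP; rewrite -subr_eq0 -coefB.
set F := (fun c : k => _); pose F' := (polyC \o (@mpolyC (n * m) k)).
rewrite -[F]/(F' : k -> _) -raddfB /= /mmap coef_sum.
rewrite big_seq big1 // => a; rewrite mcoeff_msupp => na.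
rewrite coefCM mmap1_jet_arc_coef ?mulr0 // ltnNge; apply: contra na => aj.
by rewrite mcoeffB mps_truncE ?fp ?subrr // ltnS (leq_trans aj).
Qed.

Lemma jet_coefD m j (f g : R) :
  jet_coef m j (f + g) = jet_coef m j f + jet_coef m j g.
Proof.
rewrite /jet_coef; have -> : mps_trunc m.+1 (f + g) = mps_trunc m.+1 f + mps_trunc m.+1 g.
  by rewrite -big_split; apply: eq_bigr => a _; rewrite scalerDl.
pose F := polyC \o (@mpolyC (n * m) k).
by rewrite -[fun c : k => _]/(F : k -> _) raddfD coefD.
Qed.

Lemma jet_coef00 (f : R) : jet_coef 0 0 f = (f 0%MM)%:MP.
Proof.
rewrite (@jet_coefE _ _ _ (f 0%MM)%:MP) //; last first.
  by move=> a; rewrite leqn0 mdeg_eq0 => /eqP ->; rewrite mpolyCK.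
pose F' := (polyC \o (@mpolyC (n * 0) k)).
by rewrite -[fun c : k => _]/(F' : k -> _) mmapC /= coefC.
Qed.

Definition jet_proj_var m : 'I_(n * m.+1) -> jet_ring m :=
  mxvec (\matrix_(i < n, j < m.+1)
     if insub (j : nat) is Some j' then 'X_(mxvec_index i (j' : 'I_m)) else 0) 0.

Definition jet_proj m : jet_ring m.+1 -> jet_ring m :=
  mmap (@mpolyC (n * m) k) (@jet_proj_var m).

HB.instance Definition _ m := GRing.RMorphism.on (@jet_proj m).

Lemma jet_projX m i (j : 'I_m.+1) : jet_proj 'X_(mxvec_index i j) =
  if insub (j : nat) is Some j' then 'X_(mxvec_index i (j' : 'I_m)) else 0.
Proof. by rewrite /jet_proj mmapX mmap1U /jet_proj_var mxvecE mxE. Qed.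

Lemma jet_proj_arc m i : map_poly (@jet_proj m) (jet_arc m.+1 i) = jet_arc m i.
Proof.
rewrite rmorph_sum big_ord_recr /= rmorphM /= map_polyC /= map_polyXn jet_projX.
rewrite insubF ?ltnn // mul0r addr0; apply: eq_bigr => j _.
rewrite rmorphM /= map_polyC /= map_polyXn jet_projX.
case: insubP => [j' _ /val_inj ->|]; first by [].
by move=> /negP; case; exact: (ltn_ord j).
Qed.

Lemma jet_proj_coef m j (f : R) :
  (j <= m)%N -> jet_proj (jet_coef m.+1 j f) = jet_coef m j f.
Proof.
move=> jm; rewrite (@jet_coefE m j f (mps_trunc m.+2 f)) //; last first.
  by move=> a aj; rewrite mps_truncE // ltnS (leq_trans aj) // leqW.
rewrite -coef_map; congr ((_ : {poly _})`_j); rewrite /mmap rmorph_sum.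
apply: eq_bigr => a _; rewrite rmorphM /= map_polyC /= /jet_proj mmapC.
congr (_ * _); rewrite /mmap1 rmorph_prod; apply: eq_bigr => i _.
by rewrite -(jet_proj_arc m i) -rmorphXn.
Qed.

(* Grading: giving x_i^(j) weight j, the element D_j(g) is homogeneous of weight
   j, so the generators D_(m.+1)(g) play no role in weights <= m. *)
Definition jet_weight_var m : 'I_(n * m.+1) -> {poly jet_ring m} :=
  mxvec (\matrix_(i < n, j < m.+1)
     ((jet_proj 'X_(mxvec_index i j))%:P * 'X^(j.+1))) 0.

Definition jet_weight m : jet_ring m.+1 -> {poly jet_ring m} :=
  mmap (polyC \o @mpolyC (n * m) k) (@jet_weight_var m).

HB.instance Definition _ m := GRing.RMorphism.on (@jet_weight m).

Lemma jet_weightX m i (j : 'I_m.+1) : jet_weight 'X_(mxvec_index i j) =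
  (jet_proj 'X_(mxvec_index i j))%:P * 'X^(j.+1).
Proof. by rewrite /jet_weight mmapX mmap1U /jet_weight_var mxvecE mxE. Qed.

Let spread (A : comNzRingType) (r : {poly A}) : {poly {poly A}} :=
  map_poly polyC r \Po ('X%:P * 'X).

Let spread_coef (A : comNzRingType) (r : {poly A}) i :
  (spread r)`_i = r`_i *: 'X^i.
Proof.
rewrite /spread comp_polyE coef_sum size_map_polyC.
under eq_bigr do
  rewrite exprMn -rmorphXn /= coef_map coefZ coefCM coefXn.
have [ir|ri] := ltnP i (size r).
  rewrite (bigD1 (Ordinal ir)) //= eqxx mulr1 big1 ?addr0 ?mul_polyC // => l li.
  rewrite (_ : (i == l) = false) ?mulr0 //.
  by apply/negbTE; rewrite eq_sym; apply: contra li => /eqP e; apply/eqP/val_inj.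
rewrite nth_default // scale0r big1 // => l _.
by rewrite (_ : (i == l) = false) ?mulr0 // gtn_eqF // (leq_trans (ltn_ord l)).
Qed.

Lemma jet_weight_coef m j (g : R) :
  jet_weight (jet_coef m.+1 j g) = jet_proj (jet_coef m.+1 j g) *: 'X^j.
Proof.
rewrite -(coef_map (@jet_proj m)) -spread_coef -(coef_map (@jet_weight m)).
congr ((_ : {poly _})`_j); rewrite /spread /mmap !rmorph_sum /=.
apply: eq_bigr => a _; rewrite !rmorphM /=.
rewrite !map_polyC /= comp_polyC [jet_weight _]mmapC [jet_proj _]mmapC.
congr (_ * _); rewrite /mmap1 !rmorph_prod; apply: eq_bigr => i _.
rewrite !rmorphXn; congr (_ ^+ _); rewrite /jet_arc !rmorph_sum /=.
apply: eq_bigr => l _; rewrite !rmorphM /=.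
rewrite !map_polyC /= !map_polyXn /= jet_weightX comp_polyC.
by rewrite rmorphXn /= comp_polyX exprMn rmorphM rmorphXn mulrA.
Qed.

Definition jet_ideal m (I : set R) : set (jet_ring m) :=
  ideal_gen [set p | exists2 g, I g &
                     exists2 j : nat, (j <= m)%N & p = jet_coef m j g].

Arguments jet_ideal m I : clear implicits.

Definition jet_closure m (I : set R) : set R :=
  [set f | forall j : nat, (j <= m)%N -> jet_ideal m I (jet_coef m j f)].

Definition arc_closure (I : set R) : set R := \bigcap_m jet_closure m I.

Lemma jet_closureS m (I : set R) : jet_closure m.+1 I `<=` jet_closure m I.
Proof.
move=> f fI j jm.
pose T := [set p | forall l, (l <= m)%N -> jet_ideal m I (jet_weight p)`_l].
have T_coef (S : set (jet_ring m.+1)) : S `<=` T -> ideal_gen S `<=` T.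
  apply: ideal_gen_min.
  - by move=> l _; rewrite raddf0 coef0; apply: ideal_gen0.
  - by move=> p q Tp Tq l lm; rewrite raddfD coefD; apply: ideal_genD; [apply: Tp|apply: Tq].
  - move=> p q Tq l lm; rewrite rmorphM coefM.
    apply: big_ind => [||i _]; first exact: ideal_gen0.
      exact: ideal_genD.
    by apply/ideal_genM/Tq; rewrite (leq_trans (leq_subr _ _)).
have: T (jet_coef m.+1 j f).
  apply: T_coef (fI j (leqW jm)) => _ [g Ig [i im ->]] l lm.
  rewrite jet_weight_coef coefZ coefXn.
  have [<-|_] := eqVneq l i; last by rewrite mulr0; apply: ideal_gen0.
  rewrite mulr1 jet_proj_coef //; apply: ideal_gen_sub.
  by exists g => //; exists l.
move=> /(_ j jm); rewrite jet_weight_coef coefZ coefXn eqxx mulr1.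
by rewrite jet_proj_coef.
Qed.

Lemma jet_closure_mono m m' (I : set R) :
  (m <= m')%N -> jet_closure m' I `<=` jet_closure m I.
Proof.
elim: m' => [|m' IH]; first by rewrite leqn0 => /eqP ->.
rewrite leq_eqVlt => /orP[/eqP -> //|/IH]; apply: subset_trans.
exact: jet_closureS.
Qed.

Lemma jet_closureD m (I : set R) f g :
  jet_closure m I f -> jet_closure m I g -> jet_closure m I (f + g).
Proof.
by move=> fI gI j jm; rewrite jet_coefD; apply: ideal_genD; [apply: fI|apply: gI].
Qed.

Lemma sub_jet_closure m (I : set R) : I `<=` jet_closure m I.
Proof. by move=> f fI j jm; apply: ideal_gen_sub; exists f => //; exists j. Qed.

End JetClosure.

Variant natoo := Fin of nat | Infty.

Declare Scope natoo_scope.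
Delimit Scope natoo_scope with oo.
Bind Scope natoo_scope with natoo.

Definition natoo_add x y :=
  if x is Fin a then if y is Fin b then Fin (a + b)%N else Infty else Infty.

Definition natoo_min x y :=
  match x, y with
  | Fin a, Fin b => Fin (minn a b)
  | Infty, _ => y
  | _, Infty => x
  end.

Definition natoo_le x y : bool :=
  match x, y with
  | _, Infty => true
  | Fin a, Fin b => (a <= b)%N
  | Infty, Fin _ => false
  end.

Notation "x + y" := (natoo_add x y) : natoo_scope.
Notation "x <= y" := (natoo_le x y) : natoo_scope.

(* An idealr is a proper ideal, given by a boolean membership test; classically
   (boolp) every proper ideal is of this form. *)
Section JetOrder.
Variables (n : nat) (k : fieldType) (I : idealr (mpseries n k)).
Local Notation R := (mpseries n k).
Local Notation Q := {ideal_quot I}.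
Local Notation J := [set` I].

(* S / I, for a set S containing I. *)
Definition mod_ideal (S : set R) : set Q := [set \pi_Q f | f in S]%qT.

Variant jet_order_spec (g : Q) : natoo -> Prop :=
  | JetOrder0 of ~ mod_ideal (@mps_max n k) g : jet_order_spec g (Fin 0)
  | JetOrderS m of mod_ideal (jet_closure m J) g
               & ~ mod_ideal (jet_closure m.+1 J) g :
      jet_order_spec g (Fin m.+1)
  | JetOrderInfty of mod_ideal (arc_closure J) g : jet_order_spec g Infty.

Lemma proper_sub_max : J `<=` @mps_max n k.
Proof.
move=> f fI; apply/mps_maxP/eqP; rewrite -[_ == _]negbK; apply/negP => /mps_unit[g fg].
by have := idealr1 I; rewrite -fg mulrC idealMr.
Qed.

Lemma jet_closure0 : jet_closure 0 J = @mps_max n k.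
Proof.
apply/seteqP; split=> f.
  move=> /(_ 0%N (leqnn _)) f0; apply/mps_maxP.
  suff: jet_coef 0 0 f = 0 by rewrite jet_coef00 => /eqP; rewrite mpolyC_eq0 => /eqP.
  apply: (@ideal_gen_min _ _ [set 0]) f0 => //=.
  - by move=> p q -> ->; rewrite addr0.
  - by move=> p q ->; rewrite mulr0.
  - move=> _ [g Ig [j + ->]]; rewrite leqn0 => /eqP ->.
    by rewrite jet_coef00 (mps_maxP g).1 //; apply: proper_sub_max.
move=> /mps_maxP f0 j; rewrite leqn0 => /eqP ->; rewrite jet_coef00 f0.
exact: ideal_gen0.
Qed.

Lemma mod_idealS (S T : set R) : S `<=` T -> mod_ideal S `<=` mod_ideal T.
Proof. by move=> ST _ [f /ST fT <-]; exists f. Qed.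

Lemma mod_jet_closure m f :
  mod_ideal (jet_closure m J) (\pi_Q f)%qT <-> jet_closure m J f.
Proof.
split=> [[g gJ gf]|fJ]; last by exists f.
have {}gf : g - f \in I by rewrite Quotient.idealrBE; apply/eqP.
rewrite -[f](subKr g); apply: jet_closureD; first exact: gJ.
by apply: sub_jet_closure; rewrite /mkset rpredN; exact: gf.
Qed.

Lemma mod_arc_closure g :
  mod_ideal (arc_closure J) g <-> forall m, mod_ideal (jet_closure m J) g.
Proof.
split=> [gJ m|]; first by apply: mod_idealS gJ => f; apply.
rewrite -[g]reprK => gJ; exists (repr g) => // m _.
exact/mod_jet_closure.
Qed.

Lemma jet_order_exists g : exists v, jet_order_spec g v.
Proof.
have [g0|g0] := pselect (mod_ideal (@mps_max n k) g); last first.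
  by exists (Fin 0); apply: JetOrder0.
have [[m [gm gm1]]|gJ] := pselect (exists m,
    mod_ideal (jet_closure m J) g /\ ~ mod_ideal (jet_closure m.+1 J) g).
  by exists (Fin m.+1); apply: JetOrderS.
exists Infty; apply/JetOrderInfty/mod_arc_closure; elim=> [|m gm].
  by rewrite jet_closure0.
by apply: contrapT => gm1; apply: gJ; exists m.
Qed.

Lemma jet_order_spec_fun g v w :
  jet_order_spec g v -> jet_order_spec g w -> v = w.
Proof.
have in0 m : mod_ideal (jet_closure m J) g -> mod_ideal (@mps_max n k) g.
  by rewrite -jet_closure0; apply/mod_idealS/jet_closure_mono.
have le m m' : mod_ideal (jet_closure m J) g ->
    ~ mod_ideal (jet_closure m'.+1 J) g -> (m <= m')%N.
  move=> gm gm'; rewrite leqNgt; apply/negP => mm'; apply: gm'.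
  by apply: mod_idealS gm; apply: jet_closure_mono.
case=> [g0|m gm gm1|/mod_arc_closure gJ];
  case=> [h0|l gl gl1|/mod_arc_closure hJ] //.
- by case: g0; apply: in0 gl.
- by case: g0; apply: (in0 0).
- by case: h0; apply: in0 gm.
- by congr (Fin _.+1); apply/eqP; rewrite eqn_leq !le.
- by case: h0; apply: (in0 0).
Qed.

Definition jet_order (g : Q) : natoo := sval (cid (jet_order_exists g)).

Lemma jet_orderP g : jet_order_spec g (jet_order g).
Proof. exact: svalP. Qed.

End JetOrder.

(* Main.v *)
Require Import Defs.
From HB Require Import structures.
From mathcomp Require Import all_boot all_order all_algebra.
From mathcomp Require Import mpoly boolp classical_sets.

Set Implicit Arguments.
Unset Strict Implicit.
Unset Printing Implicit Defensive.

(** The coefficients [D_j] are multiplicative in the sense of power series in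
    [t]: [D_j(f g)] is the sum of the [D_i(f) D_(j-i)(g)].  Call [f] of jet
    order at least [v] when [D_i(f)] lies in the [m]-th jet ideal for all
    [i < v] and all [m >= i] ([jet_order_ge]).  If [f] and [g] have orders at
    least [a] and [b] and [j < a + b], then every term of [D_j(f g)] has
    [i < a] or [j - i < b], so it lies in the jet ideal; this is
    [jet_order_geM].  Stability under sums is immediate.

    What remains is to identify this filtration with the one defining the jet
    order, that is, to show that orders at least [m + 1] are exactly the [m]-th
    jet closure ([jet_order_geS]).  Here the level at which [D_i(f)] is computed
    must be changed from [i] up to any [m >= i].  The inclusion [jet_incl] of
    jet rings does this: [D_i(f)] involves only the variables [x^(1)], ...,
    [x^(i)], so it is the same element at both levels ([jet_incl_coef]), and
    the generators of the [i]-th jet ideal are among those of the [m]-th. *)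

Local Open Scope ring_scope.
Import GRing.Theory.

Section JetFiltration.
Variables (n : nat) (k : comNzRingType).
Local Notation R := (mpseries n k).
Local Notation jet_ring m := {mpoly k[n * m]}.
Implicit Types (f g : R).

Lemma jet_coefM m j f g : (j <= m)%N ->
  jet_coef m j (f * g) =
  \sum_(i < j.+1) jet_coef m i f * jet_coef m (j - i) g.
Proof.
move=> jm; rewrite (@jet_coefE _ _ _ _ _ (mps_trunc m.+1 f * mps_trunc m.+1 g)) //.
  pose F := polyC \o (@mpolyC (n * m) k).
  by rewrite -[fun c : k => _]/(F : k -> _) rmorphM coefM.
move=> a aj; apply: (@mps_mul_trunc _ _ m.+1); last by rewrite ltnS (leq_trans aj).
- by move=> b bm; rewrite mps_truncE.
- by move=> b bm; rewrite mps_truncE.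
Qed.

Definition jet_incl_var {i m} (im : (i <= m)%N) : 'I_(n * i) -> jet_ring m :=
  mxvec (\matrix_(l < n, j < i) 'X_(mxvec_index l (widen_ord im j))) 0.

Definition jet_incl {i m} (im : (i <= m)%N) : jet_ring i -> jet_ring m :=
  mmap (@mpolyC (n * m) k) (jet_incl_var im).

HB.instance Definition _ i m (im : (i <= m)%N) := GRing.RMorphism.on (jet_incl im).

(** The arc at level [m] has the extra terms [x_l^(j) t^j] with [i < j <= m], all
    divisible by [t^(i+1)]. *)
Lemma jet_incl_arc i m (im : (i <= m)%N) l : exists B,
  jet_arc k m l = map_poly (jet_incl im) (jet_arc k i l) + B * 'X^(i.+1).
Proof.
(* The variable x_l^(j+1), or 0 out of range; a total function of j lets the
   arc be cut at i as a sum over natural numbers. *)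
pose V (j : nat) : {poly jet_ring m} :=
  if insub j is Some j' then ('X_(mxvec_index l (j' : 'I_m)))%:P else 0.
exists (\sum_(j < m - i) V (i + j)%N * 'X^j).
have -> : jet_arc k m l = \sum_(0 <= j < m) V j * 'X^(j.+1).
  rewrite big_mkord; apply: eq_bigr => j _; congr (_ * _).
  by rewrite /V; case: insubP => [j' _ /val_inj ->|]; rewrite ?ltn_ord.
rewrite (big_cat_nat (leq0n i) im) /=; congr (_ + _).
  rewrite big_mkord rmorph_sum; apply: eq_bigr => j _.
  rewrite rmorphM /= map_polyC /= map_polyXn /jet_incl mmapX mmap1U.
  rewrite /jet_incl_var mxvecE mxE; congr (_ * _).
  rewrite /V; case: insubP => [j' _ e|]; last by rewrite (leq_trans (ltn_ord j)).
  by congr ('X_(mxvec_index _ _))%:P; apply: val_inj.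
rewrite -[X in \sum_(X <= _ < _) _]add0n big_addn big_mkord mulr_suml.
by apply: eq_bigr => j _; rewrite -mulrA -exprD addnS [(j + i)%N]addnC.
Qed.

Lemma jet_incl_coef i m (im : (i <= m)%N) j f : (j <= i)%N ->
  jet_incl im (jet_coef i j f) = jet_coef m j f.
Proof.
move=> ji; rewrite (@jet_coefE _ _ m j f (mps_trunc i.+1 f)) ?(leq_trans ji) //; last first.
  by move=> a aj; rewrite mps_truncE // ltnS (leq_trans aj).
(* Congruence modulo t^(i+1) of polynomials in t. *)
pose eqm (p q : {poly jet_ring m}) := exists B, q = p + B * 'X^(i.+1).
have eqm_refl p : eqm p p by exists 0; rewrite mul0r addr0.
have eqmM p p' q q' : eqm p p' -> eqm q q' -> eqm (p * q) (p' * q').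
  move=> [B ->] [C ->]; exists (p * C + B * q + B * C * 'X^(i.+1)).
  by rewrite !mulrDl !mulrDr -!mulrA !addrA ['X^_ * q]mulrC ['X^_ * (C * _)]mulrCA.
have eqmD p p' q q' : eqm p p' -> eqm q q' -> eqm (p + q) (p' + q').
  by move=> [B ->] [C ->]; exists (B + C); rewrite mulrDl addrACA.
have eqm_coef p q : eqm p q -> p`_j = q`_j.
  by move=> [B ->]; rewrite coefD coefMXn ltnS ji addr0.
rewrite /jet_coef -coef_map; apply: eqm_coef; rewrite /mmap rmorph_sum.
apply: big_ind2 => [//||]; first exact: eqmD.
move=> a _; rewrite rmorphM /= map_polyC /= [jet_incl _ _]mmapC.
apply: (eqmM) => //; rewrite /mmap1 rmorph_prod.
apply: big_ind2 => [//||l _]; first exact: eqmM.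
rewrite rmorphXn; elim: (a l) => [|e IH]; first by rewrite !expr0.
by rewrite !exprS; apply: (eqmM) => //; apply: jet_incl_arc.
Qed.

Lemma jet_ideal_incl i m (im : (i <= m)%N) (I : set R) p :
  jet_ideal (m := i) I p -> jet_ideal (m := m) I (jet_incl im p).
Proof.
apply: (@ideal_gen_min _ _ [set p | jet_ideal (m := m) I (jet_incl im p)]%classic).
- by rewrite /mkset rmorph0; apply: ideal_gen0.
- by move=> q r Iq Ir; rewrite /mkset rmorphD; apply: ideal_genD.
- by move=> q r Ir; rewrite /mkset rmorphM; apply: ideal_genM.
move=> _ [g Ig [j ji ->]]; rewrite /mkset jet_incl_coef //; apply: ideal_gen_sub.
by exists g => //; exists j; rewrite // (leq_trans ji).
Qed.

(** Unlike the jet closures, whose index is shifted by one, this filtration also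
    has a term for [v = 0], the whole ring.  Quantifying over all [m] makes
    coefficients of series of different orders comparable in one jet ring. *)
Definition jet_order_ge (I : set R) v : set R := fun f =>
  forall m j, (j < v)%N -> (j <= m)%N -> jet_ideal (m := m) I (jet_coef m j f).

Lemma jet_order_geS (I : set R) v f :
  jet_order_ge I v.+1 f <-> jet_closure v I f.
Proof.
split=> [fI j jv|fI m j jv jm]; first exact: fI.
rewrite -(jet_incl_coef jm) //; apply: jet_ideal_incl.
exact: (jet_closure_mono (jv : (j <= v)%N) fI (leqnn j)).
Qed.

Lemma jet_order_geD (I : set R) v f g :
  jet_order_ge I v f -> jet_order_ge I v g -> jet_order_ge I v (f + g).
Proof.
move=> fI gI m j jv jm; rewrite jet_coefD.
by apply: ideal_genD; [apply: fI|apply: gI].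
Qed.

Lemma jet_order_geM (I : set R) a b f g :
  jet_order_ge I a f -> jet_order_ge I b g -> jet_order_ge I (a + b) (f * g).
Proof.
move=> fI gI m j jab jm; rewrite jet_coefM //.
apply: big_ind => [||i _]; [exact: ideal_gen0|exact: ideal_genD|].
have ij : (i <= j)%N by rewrite -ltnS.
have [ia|ai] := ltnP i a.
  by rewrite mulrC; apply/ideal_genM/fI; rewrite // (leq_trans ij).
apply/ideal_genM/gI; last by rewrite (leq_trans (leq_subr _ _)).
by rewrite ltn_subLR // (leq_trans jab) // leq_add2r.
Qed.

End JetFiltration.

Section JetOrderFiltration.
Variables (n : nat) (k : fieldType) (I : idealr (mpseries n k)).
Local Notation Q := {ideal_quot I}.
Local Notation J := [set` I]%classic.

(** Order [m + 1] records membership in the [m]-th closure, and order [0]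
    records failure for the maximal ideal, which is the closure at level [0];
    hence this one equivalence covers all three cases defining the order. *)
Lemma jet_order_geP v f :
  (Fin v <= jet_order (\pi_Q f)%qT)%oo <-> jet_order_ge J v f.
Proof.
case: v => [|v]; first by split=> // _; case: (jet_order _).
rewrite jet_order_geS; case: jet_orderP => [f0|m fm fm1|/mod_arc_closure fJ].
- split=> // fv; case: f0; rewrite -(jet_closure0 I).
  exact/mod_jet_closure/(jet_closure_mono (leq0n v) fv).
- split=> [vm|fv]; last first.
    rewrite /= ltnS leqNgt; apply/negP => mv; apply: fm1.
    exact/mod_jet_closure/(jet_closure_mono mv fv).
  exact: (jet_closure_mono (vm : (v <= m)%N) ((mod_jet_closure I m f).1 fm)).
- by split=> // _; apply/mod_jet_closure.
Qed.

Lemma jet_order_add v (x y : Q) : (Fin v <= jet_order x)%oo ->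
  (Fin v <= jet_order y)%oo -> (Fin v <= jet_order (x + y)%R)%oo.
Proof.
rewrite -[x]reprK -[y]reprK -rmorphD /= => /jet_order_geP xv /jet_order_geP yv.
exact/jet_order_geP/jet_order_geD.
Qed.

Lemma jet_order_mul a b (x y : Q) : (Fin a <= jet_order x)%oo ->
  (Fin b <= jet_order y)%oo -> (Fin (a + b) <= jet_order (x * y)%R)%oo.
Proof.
rewrite -[x]reprK -[y]reprK -rmorphM /= => /jet_order_geP xa /jet_order_geP yb.
exact/jet_order_geP/jet_order_geM.
Qed.

Lemma jet_order1 : jet_order (1 : Q) = Fin 0.
Proof.
suff: ~ (Fin 1 <= jet_order (1 : Q))%oo by case: (jet_order _) => [[]|].
rewrite -(rmorph1 \pi_Q%qT) => /jet_order_geP/jet_order_geS.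
rewrite jet_closure0 => /mps_maxP /eqP.
by rewrite mps1 eqxx oner_eq0.
Qed.

End JetOrderFiltration.

Lemma natoo_le_fin u w :
  (forall v, (Fin v <= u)%oo -> (Fin v <= w)%oo) -> (u <= w)%oo.
Proof.
case: u w => [a|] [b|] //= H; first exact: H.
by have := H b.+1 isT; rewrite ltnn.
Qed.

Lemma jet_order0 n (k : fieldType) (I : idealr (mpseries n k)) :
  jet_order (0 : {ideal_quot I}) = Infty.
Proof.
suff: (Infty <= jet_order (0 : {ideal_quot I}))%oo by case: (jet_order _).
apply: natoo_le_fin => -[|v] _; first by case: (jet_order _).
rewrite -(rmorph0 \pi_({ideal_quot I})%qT).
by apply/jet_order_geP/jet_order_geS/sub_jet_closure; rewrite /mkset rpred0.
Qed.

Theorem proposition6p12 (k : closedFieldType) (hk : [pchar k] =i pred0)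
    (n : nat) (I : idealr (mpseries n k)) :
  (jet_order (1 : {ideal_quot I}) = Fin 0 /\
   jet_order (0 : {ideal_quot I}) = Infty) /\
  (forall x y : {ideal_quot I},
     (natoo_min (jet_order x) (jet_order y) <= jet_order (x + y)%R)%oo) /\
  (forall x y : {ideal_quot I},
     (jet_order x + jet_order y <= jet_order (x * y)%R)%oo).
Proof.
split; first by split; [apply: jet_order1|apply: jet_order0].
split=> x y; apply: natoo_le_fin => v vxy.
  suff /andP[vx vy] : ((Fin v <= jet_order x) && (Fin v <= jet_order y))%oo.
    exact: jet_order_add.
  case: (jet_order x) (jet_order y) vxy => [a|] [b|] //=; rewrite ?andbT //.
  by rewrite leq_min.
(* A finite v below the sum splits as a sum of finite lower bounds; when one
   of the orders is infinite, it absorbs all of v. *)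
suff [a [b [vab ax yb]]] : exists a b, [/\ (v <= a + b)%N,
    (Fin a <= jet_order x)%oo & (Fin b <= jet_order y)%oo].
  have := jet_order_mul ax yb.
  by case: (jet_order _) => //= c; apply: leq_trans.
case: (jet_order x) (jet_order y) vxy => [a|] [b|] //= vxy.
- by exists a, b.
- by exists 0%N, v.
- by exists v, 0%N; rewrite addn0.
- by exists v, 0%N; rewrite addn0.
Qed.
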